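(* Let $\mathbb{H}$ be a complex Hilbert space and let $T\in B(\mathbb{H})$. Then $$\frac14 m\left(\left(\mathrm{Re}(T^2)\right)^2\right)+\frac1{16}\|T^*T+TT^*\|^2\leq w^4(T)\leq \frac12 w^2(T^2)+\frac18\|T^*T+TT^*\|^2.$$
   Context: $B(\mathbb{H})$ is the algebra of bounded linear operators on $\mathbb{H}$ and $\|\cdot\|$ the operator norm. For $S\in B(\mathbb{H})$: the numerical radius is $w(S)=\sup\{|\langle Sx,x\rangle|: x\in\mathbb{H},\ \|x\|=1\}$, and $w^k(S)=(w(S))^k$; the Crawford number is $m(S)=\inf\{|\langle Sx,x\rangle|: x\in\mathbb{H},\ \|x\|=1\}$; and $\mathrm{Re}(S)=\frac{S+S^*}{2}$. *)

(* Defs.v *)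
From HB Require Import structures.
From mathcomp Require Import all_boot all_order all_algebra.
From mathcomp Require Import complex.
From mathcomp Require Import boolp classical_sets reals topology normedtype.

Set Implicit Arguments.
Unset Strict Implicit.
Unset Printing Implicit Defensive.

Import Order.TTheory GRing.Theory Num.Theory.

Local Open Scope classical_set_scope.
Local Open Scope ring_scope.

(* The inner product is linear in its first argument and conjugate-linear in
   the second, and it induces the norm of the complete normed space H. *)
HB.mixin Record CompleteNormedModule_isHilbert (R : realType) H
    & @CompleteNormedModule R[i] H := {
  inner : {dot H for (@Num.conj R[i])} ;
  inner_norm : forall x : H, `|x| ^+ 2 = inner x x
}.

#[short(type="hilbertType")]
HB.structure Definition Hilbert (R : realType) :=
  {H of @CompleteNormedModule R[i] H & CompleteNormedModule_isHilbert R H}.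

(* In a normed space over R[i] the norm `|x| is an element of R[i], with zero
   imaginary part; rnorm x is the same number as an element of R.  It applies
   to vectors as well as to complex scalars (modulus). *)
Definition rnorm (R : realType) (V : normedZmodType R[i]) (x : V) : R :=
  complex.Re `|x|.

Section Operators.
Context {R : realType} {H : hilbertType R}.
Implicit Types S : H -> H.

Definition bounded_op S : Prop :=
  exists M : R, forall x : H, rnorm (S x) <= M * rnorm x.

Definition opnorm S : R := sup [set rnorm (S x) | x in [set x | rnorm x <= 1]].

Definition numerical_radius S : R :=
  sup [set rnorm (inner (S x) x) | x in [set x | rnorm x = 1]].

Definition crawford_number S : R :=
  inf [set rnorm (inner (S x) x) | x in [set x | rnorm x = 1]].

(* S^* y is the vector z with <S x, y> = <x, z> for all x; for a bounded linear
   S it exists and is unique by the Riesz representation theorem. *)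
Definition adjoint S : H -> H :=
  fun y => get [set z | forall x, inner (S x) y = inner x z].

Definition real_part S : H -> H := fun x => 2^-1 *: (S x + adjoint S x).

End Operators.

(* Main.v *)
(* Write T' for the adjoint of T and, for |u| = 1 with conjugate v, put
   A_u = (u T + v T') / 2.  It is self-adjoint and
   <A_u x, x> = Re (u <T x, x>), so |A_u x| <= w(T) |x|; moreover
   4 A_u^2 = u^2 T^2 + (T'T + TT') + v^2 T'^2.
   Lower bound: A_1^2 + A_i^2 = (T'T + TT') / 2 and A_1^2 - A_i^2 = Re (T^2),
   so the parallelogram law gives, for unit x,
     |(T'T + TT') x|^2 / 4 + |Re (T^2) x|^2
       = 2 (|A_1^2 x|^2 + |A_i^2 x|^2) <= 4 w(T)^4.
   Upper bound: choose u with u <T x, x> = |<T x, x>|; this number is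
   <A_u x, x>, whose square is at most <A_u^2 x, x>, hence at most
   w(T^2) / 2 + |T'T + TT'| / 4; square once more.
   The adjoint exists by the Riesz representation theorem, where the vector
   representing phi minimizes |x|^2 - 2 Re (phi x). *)
From HB Require Import structures.
Require Import Defs.
From mathcomp Require Import all_boot all_order all_algebra.
From mathcomp Require Import complex.
From mathcomp Require Import boolp classical_sets reals topology normedtype.
From mathcomp Require Import ring lra.

Set Implicit Arguments.
Unset Strict Implicit.
Unset Printing Implicit Defensive.

Import Order.TTheory GRing.Theory Num.Theory.

Local Open Scope classical_set_scope.
Local Open Scope ring_scope.

(** For [a > 0], evaluate at the minimizer [- b / a]. For [a = 0] and nonzero [b], the affine
    function would take the value -1 somewhere. *)
Lemma discr_le0 (F : realFieldType) (a b c : F) :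
  0 <= a -> (forall t, 0 <= a * t ^+ 2 + 2 * b * t + c) -> b ^+ 2 <= a * c.
Proof.
rewrite le_eqVlt => /predU1P[<-|a_gt0] q_ge0.
  have [->|b0] := eqVneq b 0; first by rewrite expr0n mul0r.
  have := q_ge0 (- (c + 1) / (2 * b)).
  have -> : 0 * (- (c + 1) / (2 * b)) ^+ 2 + 2 * b * (- (c + 1) / (2 * b)) + c
    = -1 by field.
  by rewrite oppr_ge0 ler10.
have := q_ge0 (- b / a).
have -> : a * (- b / a) ^+ 2 + 2 * b * (- b / a) + c = (a * c - b ^+ 2) / a.
  by field; rewrite gt_eqF.
by rewrite pmulr_lge0 ?invr_gt0 // subr_ge0.
Qed.

(** * The real inner product underlying the complex one *)

Section RealInner.
Context {R : realType} {H : hilbertType R}.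
Implicit Types (x y z : H) (a b : R).

(** Real parts keep the scalars in an ordered field and make the form symmetric; what is lost is
    recovered by rotating vectors. *)
Definition rip x y : R := complex.Re (inner x y).

Lemma innerC x y : inner x y = (inner y x)^*.
Proof. by rewrite hermC expr0 mul1r. Qed.

Lemma ReD (z w : R[i]) : complex.Re (z + w) = complex.Re z + complex.Re w.
Proof. by case: z w => ? ? []. Qed.

Lemma ReN (z : R[i]) : complex.Re (- z) = - complex.Re z.
Proof. by case: z. Qed.

Lemma ReZ a (z : R[i]) : complex.Re (a%:C%C * z) = a * complex.Re z.
Proof. by case: z => ? ? /=; rewrite mul0r subr0. Qed.

Lemma ripC x y : rip x y = rip y x.
Proof. by rewrite /rip innerC; case: (inner y x). Qed.

Lemma ripDl x y z : rip (x + y) z = rip x z + rip y z.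
Proof. by rewrite /rip linearDl ReD. Qed.

Lemma ripNl x z : rip (- x) z = - rip x z.
Proof. by rewrite /rip linearNl ReN. Qed.

Lemma ripZl a x z : rip (a%:C%C *: x) z = a * rip x z.
Proof. by rewrite /rip linearZl_LR ReZ. Qed.

Lemma ripDr x y z : rip x (y + z) = rip x y + rip x z.
Proof. by rewrite !(ripC x) ripDl. Qed.

Lemma ripNr x y : rip x (- y) = - rip x y.
Proof. by rewrite !(ripC x) ripNl. Qed.

Lemma ripZr a x y : rip x (a%:C%C *: y) = a * rip x y.
Proof. by rewrite !(ripC x) ripZl. Qed.

Definition ripE := (ripDl, ripDr, ripNl, ripNr, ripZl, ripZr).

Lemma rnormE (V : normedZmodType R[i]) (v : V) : `|v| = (rnorm v)%:C%C.
Proof. by rewrite /rnorm RRe_real // normr_real. Qed.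

Lemma rnorm_ge0 (V : normedZmodType R[i]) (v : V) : 0 <= rnorm v.
Proof. by rewrite -ler0c -rnormE. Qed.

Lemma rnorm_eq0 (V : normedZmodType R[i]) (v : V) : (rnorm v == 0) = (v == 0).
Proof. by rewrite -[RHS]normr_eq0 rnormE eq_complex eqxx andbT. Qed.

Lemma rnormZ (V : normedModType R[i]) (k : R[i]) (v : V) :
  rnorm (k *: v) = rnorm k * rnorm v.
Proof.
rewrite [in LHS]/rnorm normrZ (rnormE k) (rnormE v) -rmorphM //.
Qed.

Lemma rnormM (k l : R[i]) : rnorm (k * l) = rnorm k * rnorm l.
Proof. exact: (@rnormZ R[i]^o). Qed.

Lemma rnormC a : rnorm (a%:C)%C = `|a|.
Proof. by rewrite /rnorm normc_def /= expr0n addr0 sqrtr_sqr. Qed.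

Lemma Re_le_rnorm (z : R[i]) : complex.Re z <= rnorm z.
Proof.
by rewrite (le_trans (ler_norm _)) // -lecR -rnormE normc_ge_Re.
Qed.

Lemma rnorm_sqr x : rnorm x ^+ 2 = rip x x.
Proof. by rewrite /rip -inner_norm rnormE -rmorphXn. Qed.

Lemma rip_ge0 x : 0 <= rip x x.
Proof. by rewrite -rnorm_sqr sqr_ge0. Qed.

(** The squared norm of x + t y is a nonnegative quadratic in t. *)
Lemma rip_sqr_le x y : rip x y ^+ 2 <= rip x x * rip y y.
Proof.
rewrite mulrC; apply: discr_le0; first exact: rip_ge0.
move=> t; have := rip_ge0 (x + t%:C%C *: y).
rewrite !ripE (ripC y x); nra.
Qed.

Lemma rip_le x y : rip x y <= rnorm x * rnorm y.
Proof.
rewrite (le_trans (ler_norm _)) // -ler_sqr ?nnegrE ?mulr_ge0 ?rnorm_ge0 //.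
by rewrite real_normK ?num_real // exprMn !rnorm_sqr rip_sqr_le.
Qed.

Lemma ex_phase (z : R[i]) : 
  exists2 u : R[i], rnorm u = 1 & u * z = (rnorm z)%:C%C.
Proof.
have [->|z0] := eqVneq z 0.
  exists 1; first by rewrite /rnorm normr1.
  by rewrite mulr0 -rnormE normr0.
exists (`|z| / z); last by rewrite divfK // -rnormE.
rewrite /rnorm normrM normr_id normfV divff // normr_eq0 //.
Qed.

(** Rotating [x] by a phase turns the modulus into a real part, to which the real Cauchy-Schwarz
    inequality applies. *)
Lemma rnorm_inner_le x y : rnorm (inner x y) <= rnorm x * rnorm y.
Proof.
have [u u1 uE] := ex_phase (inner x y).
have -> : rnorm (inner x y) = rip (u *: x) y by rewrite /rip linearZl_LR uE.
by rewrite (le_trans (rip_le _ _)) // rnormZ u1 mul1r.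
Qed.

Lemma rip_ext x y : (forall z, rip x z = rip y z) -> x = y.
Proof.
move=> xy; apply/eqP; rewrite -subr_eq0 -rnorm_eq0 -sqrf_eq0 rnorm_sqr.
by rewrite ripDl ripNl xy subrr.
Qed.

End RealInner.

(** * Riesz representation by minimization *)

Section Riesz.
Context {R : realType} {H : hilbertType R}.
Variables (phi : H -> R[i]) (M : R).
Hypothesis phi_scalar : scalar phi.
Hypothesis phi_bounded : forall x, rnorm (phi x) <= M * rnorm x.

Let f x : R := complex.Re (phi x).

Let fD x y : f (x + y) = f x + f y.
Proof. by rewrite /f -{1}[x]scale1r phi_scalar mul1r ReD. Qed.

Let fZ (a : R) x : f (a%:C%C *: x) = a * f x.
Proof.
have phi0 : phi 0 = 0.
  have := phi_scalar (- 1) 0 0; rewrite scaler0 addr0 => ->.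
  by rewrite mulN1r addNr.
by rewrite /f -[_ *: x]addr0 phi_scalar phi0 addr0 ReZ.
Qed.

(** If z represents [phi], this is |x - z|^2 - |z|^2, which is minimal at z only. *)
Let energy x : R := rip x x - 2 * f x.

Let d := inf (range energy).

Let f_le x : f x <= M * rnorm x.
Proof. exact: le_trans (Re_le_rnorm _) (phi_bounded x). Qed.

Let energy_has_inf : has_inf (range energy).
Proof.
split; first by exists (energy 0), 0.
exists (- M ^+ 2) => _ [x _ <-]; rewrite /energy -rnorm_sqr.
have := f_le x; have := sqr_ge0 (rnorm x - M); nra.
Qed.

Let energy_ge x : d <= energy x.
Proof. by apply: ge_inf; [exact: energy_has_inf.2 | exists x]. Qed.

Let near_min (e : R) : set H := [set x | energy x <= d + e].

Let near_min_neq0 e : 0 < e -> near_min e !=set0.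
Proof.
move=> e0; have [_ [x _ <-] xe] := inf_adherent e0 energy_has_inf.
by exists x; exact: ltW.
Qed.

(* The parallelogram law at the midpoint of [x] and [y]. *)
Let near_min_dist e x y :
  near_min e x -> near_min e y -> rip (x - y) (x - y) <= 4 * e.
Proof.
rewrite /near_min /= => xe ye.
have := energy_ge ((2^-1)%:C%C *: (x + y)); move: xe ye.
rewrite /energy !ripE fZ fD (ripC y x); lra.
Qed.

(** Moving from [x] by t v lowers the energy by at most [e], for every t; the discriminant then
    bounds the first-order term. At [e = 0] this is the Euler equation. *)
Let near_min_variation e x v :
  near_min e x -> (rip x v - f v) ^+ 2 <= rip v v * e.
Proof.
move=> xe; apply: discr_le0; first exact: rip_ge0.
move=> t; have := energy_ge (x + t%:C%C *: v); move: xe.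
rewrite /near_min /= /energy !ripE fD fZ (ripC v x); nra.
Qed.

(** The sets [near_min e] shrink with [e]; the filter they generate stands in for a minimizing
    sequence. *)
Let minimizing := filter_from [set e : R | 0 < e] near_min.

Let minimizing_proper : ProperFilter minimizing.
Proof.
apply: filter_from_proper; last exact: near_min_neq0.
apply: filter_from_filter; first by exists 1; exact: ltr01.
move=> e e' /= e0 e'0; exists (Num.min e e'); first by rewrite lt_min e0.
by move=> x; rewrite /near_min /= => xe; split; apply: le_trans xe _;
  rewrite lerD2l ge_min lexx ?orbT.
Qed.

(** The constant 8 makes the squared distance between near-minimizers at most [r ^+ 2 / 2], hence
    strictly below [r ^+ 2]. *)
Let near_min_ball (r : R) x : 0 < r -> near_min (r ^+ 2 / 8) x ->
  near_min (r ^+ 2 / 8) `<=` ball x r%:C%C.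
Proof.
move=> r0 xr y yr; rewrite -ball_normE /= rnormE ltcR.
rewrite -ltr_sqr ?nnegrE ?rnorm_ge0 ?ltW // rnorm_sqr.
apply: le_lt_trans (near_min_dist xr yr) _.
by have := exprn_gt0 2 r0; lra.
Qed.

Let minimizing_cauchy : cauchy minimizing.
Proof.
have [_ F] := minimizing_proper; apply: cauchy_exP => r0.
(* Radii are complex here; positivity forces a zero imaginary part. *)
rewrite ltcE /= => /andP[/eqP ri r_gt0].
have -> : r0 = (complex.Re r0)%:C%C by case: r0 ri r_gt0 => ? ? /= ->.
have e0 : 0 < complex.Re r0 ^+ 2 / 8 by rewrite divr_gt0 ?exprn_gt0.
have [x xe] := near_min_neq0 e0.
by exists x, (complex.Re r0 ^+ 2 / 8) => //; exact: near_min_ball.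
Qed.

Theorem riesz : exists z, forall x, phi x = inner x z.
Proof.
have FF := minimizing_proper.
have /cvg_ex[z cvz] : cvg minimizing by exact: cauchy_cvg.
(* Equality of real parts is enough: at i x it yields the imaginary parts at x. *)
suff zf v : f v = rip v z.
  exists z => x.
  have phiZ (u : R[i]) : phi (u *: x) = u * phi x.
    have := phi_scalar u x 0; rewrite addr0 => ->.
    have := phi_scalar (- 1) 0 0; rewrite scaler0 addr0 => ->.
    by rewrite mulN1r addNr addr0.
  have := zf ('i%C *: x); have := zf x.
  rewrite /f /rip phiZ linearZl_LR /=.
  case: (phi x) (inner x z) => a b [c e] /=.
  by move=> ->; rewrite !mul0r !mul1r !sub0r => /oppr_inj ->.
apply/eqP; rewrite -subr_eq0 -sqrf_eq0 eq_le sqr_ge0 andbT.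
apply/ler_addgt0Pl => e e0; rewrite addr0.
(* Choose [s] with 4 s |v|^2 <= e; the added 1 keeps the divisor positive. A point [x] of
   [near_min s] within sqrt s of [z] makes both <z - x, v>^2 and (<x, v> - f v)^2 at most s |v|^2,
   with real inner products. *)
pose k := 4 * (rip v v + 1).
have k0 : 0 < k by rewrite /k; have := rip_ge0 v; lra.
pose s := e / k; have s0 : 0 < s by rewrite divr_gt0.
have nz : nbhs z (ball z (Num.sqrt s)%:C%C).
  by apply: nbhsx_ballx; rewrite ltcR sqrtr_gt0.
have ms : minimizing (near_min s) by exists s.
have [x [xs zx]] := filter_ex (filterI ms (cvz _ nz)).
have := near_min_variation v xs.
have : rip (z - x) v ^+ 2 <= s * rip v v.
  apply: le_trans (rip_sqr_le _ _) _; apply: ler_wpM2r; first exact: rip_ge0.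
  move: zx; rewrite -ball_normE /= rnormE ltcR -rnorm_sqr => /ltW zx.
  rewrite -[leRHS]sqr_sqrtr ?(ltW s0) //.
  by rewrite ler_sqr ?nnegrE ?rnorm_ge0 ?sqrtr_ge0.
have -> : e = s * (4 * (rip v v + 1)) by rewrite /s -/k divfK // gt_eqF.
rewrite ripDl ripNl (ripC v z).
(* This is (a + b)^2 <= 2 a^2 + 2 b^2 for a = <z - x, v> and b = <x, v> - f v; the square supplied
   is (a - b)^2. *)
have := sqr_ge0 (rip z v + f v - 2 * rip x v); nra.
Qed.

End Riesz.

(** The default value 0 of [sup] covers sets without a supremum. *)
Lemma sup_ge0 (R : realType) (E : set R) :
  (forall e, E e -> 0 <= e) -> 0 <= sup E.
Proof.
move=> E_ge0; have [E_sup|/sup_out-> //] := pselect (has_sup E).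
have [e Ee] := E_sup.1.
exact: le_trans (E_ge0 e Ee) (sup_upper_bound E_sup Ee).
Qed.

(** * Numerical radius, Crawford number, operator norm and adjoint *)

Section Operators.
Context {R : realType} {H : hilbertType R}.
Implicit Types (x y : H).

Lemma normalize x :
  x != 0 -> exists2 u : H, rnorm u = 1 & x = (rnorm x)%:C%C *: u.
Proof.
move=> x0; have nx0 : rnorm x != 0 by rewrite rnorm_eq0.
exists ((rnorm x)^-1%:C%C *: x); last first.
  by rewrite scalerA -rmorphM mulfV // scale1r.
by rewrite rnormZ rnormC ger0_norm ?invr_ge0 ?rnorm_ge0 // mulVf.
Qed.

Lemma rnorm_inner_scale (S : {linear H -> H}) (a : R) x :
  rnorm (inner (S (a%:C%C *: x)) (a%:C%C *: x)) =
    a ^+ 2 * rnorm (inner (S x) x).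
Proof.
rewrite [S _]linearZ linearZl_LR linearZr_LR /= !rnormM.
have -> : (a%:C%C : R[i])^* = a%:C%C by exact: conjc_real.
by rewrite rnormC mulrA -expr2 real_normK ?num_real.
Qed.

Lemma bounded_comp (S S' : H -> H) :
  bounded_op S -> bounded_op S' -> bounded_op (S \o S').
Proof.
move=> [M SM] [M' SM']; exists (`|M| * M') => x.
apply: le_trans (SM _) _; rewrite -mulrA.
apply: le_trans (ler_wpM2l (normr_ge0 M) (SM' x)).
by rewrite ler_wpM2r ?rnorm_ge0 ?ler_norm.
Qed.

Lemma rnormD x y : rnorm (x + y) <= rnorm x + rnorm y.
Proof.
by rewrite -lecR rmorphD /= -!rnormE ler_normD.
Qed.

Lemma bounded_add (S S' : H -> H) :
  bounded_op S -> bounded_op S' -> bounded_op (S \+ S').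
Proof.
move=> [M SM] [M' SM']; exists (M + M') => x.
by rewrite mulrDl (le_trans (rnormD _ _)) // lerD.
Qed.

Lemma numerical_radius_ge0 (S : H -> H) : 0 <= numerical_radius S.
Proof. by apply: sup_ge0 => _ [x _ <-]; exact: rnorm_ge0. Qed.

(** Homogeneity reduces to a unit vector; boundedness of [S] and Cauchy-Schwarz make the supremum a
    genuine one. *)
Lemma numerical_radius_ge (S : {linear H -> H}) x : bounded_op S ->
  rnorm (inner (S x) x) <= numerical_radius S * rnorm x ^+ 2.
Proof.
move=> [M SM]; have [->|x0] := eqVneq x 0.
  rewrite linear0r.
  have -> : rnorm (0 : R[i]) = 0 by apply/eqP; rewrite rnorm_eq0.
  by rewrite mulr_ge0 ?numerical_radius_ge0 ?sqr_ge0.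
have [u u1 ->] := normalize x0.
rewrite rnorm_inner_scale rnormZ u1 mulr1 rnormC real_normK ?num_real // mulrC.
rewrite ler_wpM2r ?sqr_ge0 //; apply: ub_le_sup; last by exists u.
exists M => _ [y /= y1 <-].
apply: le_trans (rnorm_inner_le _ _) _; rewrite y1 mulr1.
by rewrite (le_trans (SM y)) ?y1 ?mulr1.
Qed.

(** [0 <= b] matters on the zero space, which has no unit vector and where the numerical radius is
    0. *)
Lemma numerical_radius_le (S : H -> H) b : 0 <= b ->
  (forall x, rnorm x = 1 -> rnorm (inner (S x) x) <= b) ->
  numerical_radius S <= b.
Proof.
move=> b0 Sb; have [ne|/nonemptyPn e0] := pselect
  ([set rnorm (inner (S x) x) | x in [set x | rnorm x = 1]] !=set0).
  by apply: ge_sup => // _ [x x1 <-]; exact: Sb.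
by rewrite /numerical_radius e0 sup0.
Qed.

Lemma crawford_number_le (S : {linear H -> H}) x :
  crawford_number S * rnorm x ^+ 2 <= rnorm (inner (S x) x).
Proof.
have [->|x0] := eqVneq x 0.
  have -> : rnorm (0 : H) = 0 by apply/eqP; rewrite rnorm_eq0.
  by rewrite expr0n mulr0 rnorm_ge0.
have [u u1 ->] := normalize x0.
rewrite rnorm_inner_scale rnormZ u1 mulr1 rnormC real_normK ?num_real // mulrC.
rewrite ler_wpM2l ?sqr_ge0 //; apply: ge_inf; last by exists u.
by exists 0 => _ [y _ <-]; exact: rnorm_ge0.
Qed.

Lemma opnorm_ge0 (S : H -> H) : 0 <= opnorm S.
Proof. by apply: sup_ge0 => _ [x _ <-]; exact: rnorm_ge0. Qed.

Lemma opnorm_ge (S : H -> H) x :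
  bounded_op S -> rnorm x <= 1 -> rnorm (S x) <= opnorm S.
Proof.
move=> [M SM] x1; apply: ub_le_sup; last by exists x.
exists `|M| => _ [y /= y1 <-]; apply: le_trans (SM y) _.
rewrite (le_trans (ler_norm _)) // normrM ler_piMr ?normr_ge0 //.
by rewrite ger0_norm ?rnorm_ge0.
Qed.

Lemma opnorm_le (S : H -> H) b :
  (forall x, rnorm x <= 1 -> rnorm (S x) <= b) -> opnorm S <= b.
Proof.
move=> Sb; apply: ge_sup; last by move=> _ [x x1 <-]; exact: Sb.
exists (rnorm (S 0)), 0 => //=.
by have -> : rnorm (0 : H) = 0; [apply/eqP; rewrite rnorm_eq0|exact: ler01].
Qed.

(** Riesz represents each functional x |-> <S x, y>; uniqueness makes the choice linear, and |S'
    y|^2 = <S S' y, y> bounds it after division by |S' y|. *)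
Lemma ex_adjoint (S : {linear H -> H}) : bounded_op S ->
  exists2 S' : {linear H -> H}, bounded_op S' &
    forall x y, inner (S x) y = inner x (S' y).
Proof.
move=> [M SM].
have S_adj y : exists z, forall x, inner (S x) y = inner x z.
  apply: (@riesz _ _ _ (`|M| * rnorm y)).
    by move=> a u v; rewrite linearP linearPl.
  move=> x; apply: le_trans (rnorm_inner_le _ _) _.
  rewrite mulrAC ler_wpM2r ?rnorm_ge0 // (le_trans (SM x)) //.
  by rewrite ler_wpM2r ?rnorm_ge0 ?ler_norm.
have [S' adj] := choice S_adj.
have S'lin : linear S'.
  move=> a u v; apply: rip_ext => z; rewrite ![rip _ z]ripC /rip.
  by rewrite -adj !linearPr /= !adj.
pose S'L : {linear H -> H} :=
  HB.pack S' (GRing.isLinear.Build _ _ _ _ S' S'lin).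
exists S'L => //=.
exists `|M| => y; have [->|y0] := eqVneq (S' y) 0.
  have -> : rnorm (0 : H) = 0 by apply/eqP; rewrite rnorm_eq0.
  by rewrite mulr_ge0 ?rnorm_ge0.
have ny0 : 0 < rnorm (S' y) by rewrite lt_def rnorm_eq0 y0 rnorm_ge0.
rewrite -(ler_pM2r ny0) -expr2 rnorm_sqr /rip -adj.
apply: le_trans (rip_le _ _) _; rewrite mulrAC ler_wpM2r ?rnorm_ge0 //.
by rewrite (le_trans (SM _)) // ler_wpM2r ?rnorm_ge0 ?ler_norm.
Qed.

(** The representing vector is unique, so the one picked by [get] is [S' y]. *)
Lemma adjointE (S S' : H -> H) :
  (forall x y, inner (S x) y = inner x (S' y)) -> adjoint S = S'.
Proof.
move=> adj; apply/funext => y.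
have /= adjP : [set z | forall x, inner (S x) y = inner x z] (adjoint S y).
  by apply: getPex; exists (S' y) => x; exact: adj.
by apply: rip_ext => z; rewrite ![rip _ z]ripC /rip -adjP adj.
Qed.

(** Polarization: with y = A x, the forms at x + t y and x - t y differ by 4 t |y|^2, while their
    bounds add up to 2 w (|x|^2 + t^2 |y|^2). The discriminant in t gives |y|^4 <= w^2 |x|^2
    |y|^2. *)
Lemma symmetric_bound (A : {linear H -> H}) w : 0 <= w ->
    (forall x y, rip (A x) y = rip x (A y)) ->
    (forall x, `|rip (A x) x| <= w * rip x x) ->
  forall x, rip (A x) (A x) <= w ^+ 2 * rip x x.
Proof.
move=> w0 A_sym Aw x; set y := A x.
have : (- rip y y) ^+ 2 <= w * rip y y * (w * rip x x).
  apply: discr_le0; first by rewrite mulr_ge0 ?rip_ge0.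
  move=> t; have := Aw (x + t%:C%C *: y); have := Aw (x + (- t)%:C%C *: y).
  rewrite !linearD !linearZ /= !ler_norml => /andP[+ _] /andP[_].
  rewrite !ripE (A_sym y x) -/y (ripC y x); nra.
rewrite sqrrN; have := rip_ge0 y; rewrite le_eqVlt => /predU1P[<- _|y0].
  by rewrite mulr_ge0 ?sqr_ge0 ?rip_ge0.
by move=> yy; rewrite -(ler_pM2l y0); nra.
Qed.

End Operators.

(** * Rotated real parts of an operator *)

Section RotatedRealPart.
Context {R : realType} {H : hilbertType R}.
Variables T T' : {linear H -> H}.
Hypothesis T_bounded : bounded_op T.
Hypothesis T_adj : forall x y, inner (T x) y = inner x (T' y).
Implicit Types (x y : H) (u : R[i]).

Let T'_adj x y : inner (T' x) y = inner x (T y).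
Proof. by rewrite innerC -T_adj -innerC. Qed.

(** The operator A_u: for u = 1 the real part of [T], for u = i minus its imaginary part. *)
Definition rot_re u : H -> H := 2^-1 \*: (u \*: T \+ u^* \*: T').
HB.instance Definition _ u := GRing.Linear.on (rot_re u).

Lemma rot_re_sym u x y : rip (rot_re u x) y = rip x (rot_re u y).
Proof.
rewrite /rip /rot_re /= !(linearZl_LR, linearZr_LR, linearDl, linearDr) /=.
by rewrite conjCK T_adj T'_adj fmorphV rmorph_nat [X in _ * X]addrC.
Qed.

Lemma rip_rot_re u x : rip (rot_re u x) x = complex.Re (u * inner (T x) x).
Proof.
rewrite /rip /rot_re /= !(linearZl_LR, linearDl) /= T'_adj.
rewrite [inner x (T x)]innerC -rmorphM.
have -> : (2^-1 : R[i]) = (2^-1)%:C%C by rewrite fmorphV rmorph_nat.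
by rewrite ReZ; case: (u * _) => a b /=; field.
Qed.

Lemma rot_re_bound u x : rnorm u = 1 ->
  rip (rot_re u x) (rot_re u x) <= numerical_radius T ^+ 2 * rip x x.
Proof.
move=> u1; apply: (@symmetric_bound _ _ (rot_re u)).
- exact: numerical_radius_ge0.
- exact: rot_re_sym.
move=> {}x; rewrite rip_rot_re -lecR (le_trans (normc_ge_Re _)) //.
rewrite rnormE lecR rnormM u1 mul1r -rnorm_sqr.
exact: numerical_radius_ge.
Qed.

(** Mixed products carry the factor [u * u^*], so the middle term does not depend on [u]. *)
Lemma rot_re_sqr u x : u * u^* = 1 ->
  rot_re u (rot_re u x) = 4^-1 *:
    (u ^+ 2 *: T (T x) + (T' (T x) + T (T' x)) + u^* ^+ 2 *: T' (T' x)).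
Proof.
move=> uu; have uu' : u^* * u = 1 by rewrite mulrC.
have -> : (4^-1 : R[i]) = 2^-1 * 2^-1 by field.
rewrite -scalerA /rot_re /= [T (2^-1 *: _)]linearZ [T' (2^-1 *: _)]linearZ /=.
have sC (a b : R[i]) (v : H) : a *: (b *: v) = b *: (a *: v).
  by rewrite !scalerA mulrC.
rewrite ![_ *: (2^-1 *: _)]sC -scalerDr.
rewrite ![T (_ + _)]linearD ![T' (_ + _)]linearD /=.
rewrite !linearZ /= !scalerDr !scalerA.
rewrite -!mulrA uu uu' !mulr1 -!expr2 -!addrA; congr (_ + _).
exact: addrCA.
Qed.

End RotatedRealPart.

Theorem theorem2p19 (R : realType) (H : hilbertType R) (T : {linear H -> H})
    (T_bounded : bounded_op T) :
  1 / 4 * crawford_number (real_part (T \o T) \o real_part (T \o T))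
    + 1 / 16 * opnorm ((adjoint T \o T) \+ (T \o adjoint T)) ^+ 2
    <= numerical_radius T ^+ 4
  /\
  numerical_radius T ^+ 4
    <= 1 / 2 * numerical_radius (T \o T) ^+ 2
       + 1 / 8 * opnorm ((adjoint T \o T) \+ (T \o adjoint T)) ^+ 2.
Proof.
have [T' T'_bounded T_adj] := ex_adjoint T_bounded.
have T'_adj x y : inner (T' x) y = inner x (T y).
  by rewrite innerC -T_adj -innerC.
have TT_adj x y : inner ((T \o T) x) y = inner x ((T' \o T') y).
  by rewrite /= !T_adj.
rewrite (adjointE T_adj).
set S := (T' \o T) \+ (T \o T').
set w := numerical_radius T.
have w0 : 0 <= w by exact: numerical_radius_ge0.
have S_bounded : bounded_op S by apply: bounded_add; exact: bounded_comp.
split.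
  (* Lower bound: [Q] is Re (T^2) with the adjoint made explicit, which exhibits its linearity. *)
  pose Q : H -> H := 2^-1 \*: ((T \o T) \+ (T' \o T')).
  have -> : real_part (T \o T) = Q.
    by apply/funext => x; rewrite /real_part (adjointE TT_adj).
  pose QL : {linear H -> H} := GRing.Linear.clone _ _ _ _ Q _.
  pose QQ : {linear H -> H} := GRing.Linear.clone _ _ _ _ (QL \o QL) _.
  set m := crawford_number _.
  have Q_sym x y : inner (Q x) y = inner x (Q y).
    rewrite /Q /= !(linearZl_LR, linearZr_LR, linearDl, linearDr) /=.
    by rewrite !T_adj !T'_adj fmorphV rmorph_nat [X in _ * X]addrC.
  (* As [Q] is symmetric, <Q^2 x, x> = |Q x|^2. *)
  have mQ x : m * rip x x <= rip (Q x) (Q x).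
    rewrite -rnorm_sqr; apply: le_trans (crawford_number_le QQ x) _.
    by rewrite /= Q_sym /rip -inner_norm /rnorm normrX normr_id.
  (* With S x = 2 (p + q) and Q x = p - q, the parallelogram law gives |S x|^2 + 4 |Q x|^2 = 8
     (|p|^2 + |q|^2) <= 16 w^4 |x|^2. *)
  have key x : rip (S x) (S x) <= (16 * w ^+ 4 - 4 * m) * rip x x.
    pose p := rot_re T T' 1 (rot_re T T' 1 x).
    pose q := rot_re T T' 'i%C (rot_re T T' 'i%C x).
    have rot_bound u : rnorm u = 1 -> rip (rot_re T T' u (rot_re T T' u x))
        (rot_re T T' u (rot_re T T' u x)) <= w ^+ 4 * rip x x.
      move=> u1; apply: le_trans (rot_re_bound T_bounded T_adj _ u1) _.
      rewrite (_ : w ^+ 4 = w ^+ 2 * w ^+ 2); last by rewrite -exprD.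
      by rewrite -mulrA ler_wpM2l ?sqr_ge0 // rot_re_bound.
    have pw : rip p p <= w ^+ 4 * rip x x.
      by apply: rot_bound; rewrite /rnorm normr1.
    have qw : rip q q <= w ^+ 4 * rip x x.
      apply: rot_bound; rewrite /rnorm normc_def /=.
      by rewrite expr0n expr1n add0r sqrtr1.
    have pE : p = 4^-1 *: (T (T x) + S x + T' (T' x)).
      by rewrite /p rot_re_sqr ?rmorph1 ?mulr1 // !expr1n !scale1r.
    have qE : q = 4^-1 *: (- T (T x) + S x - T' (T' x)).
      have iJ : ('i%C : R[i])^* = - 'i%C.
        by apply/eqP; rewrite eq_complex /= oppr0 !eqxx.
      rewrite /q rot_re_sqr iJ ?mulrN -?expr2 ?sqrrN ?sqr_i ?opprK //.
      by rewrite !scaleN1r.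
    have Sx : S x = 2%:C%C *: (p + q).
      rewrite pE qE -scalerDr addrACA (addrACA (T (T x))) !subrr add0r addr0.
      rewrite -mulr2n -[S x *+ 2]scaler_nat !scalerA rmorph_nat.
      have -> : 2 * (4^-1 * 2) = 1 :> R[i] by field.
      by rewrite scale1r.
    have Qx : Q x = p - q.
      rewrite pE qE -scalerBr opprB (opprD (- _)) opprK [T' (T' x) + _]addrC.
      rewrite addrACA (addrACA (T (T x))) subrr addr0.
      rewrite -!mulr2n -mulrnDl -[(_ + _) *+ 2]scaler_nat scalerA.
      by have -> : 4^-1 * 2 = 2^-1 :> R[i] by field.
    have := mQ x; move: pw qw; rewrite Qx Sx !ripE (ripC q p); lra.
  (* This lets the bound on [opnorm S ^+ 2] be written as the square of a square root. *)
  have m_le : m <= 4 * w ^+ 4.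
    have [|no_unit] := pselect (exists x : H, rnorm x = 1).
      move=> [x x1]; have := key x; have := rip_ge0 (S x).
      by rewrite -[rip x x]rnorm_sqr x1; lra.
    (* On the zero space the infimum is over the empty set, hence is [0]. *)
    have -> : m = 0; last by rewrite mulr_ge0 ?exprn_ge0.
    rewrite /m /crawford_number; set E := [set _ | _ in _].
    have -> : E = set0; last exact: inf0.
    by apply/nonemptyPn => -[_ [x x1 _]]; apply: no_unit; exists x.
  have K0 : 0 <= 16 * w ^+ 4 - 4 * m by lra.
  have : opnorm S ^+ 2 <= 16 * w ^+ 4 - 4 * m.
    rewrite -[leRHS]sqr_sqrtr // ler_sqr ?nnegrE ?sqrtr_ge0 ?opnorm_ge0 //.
    apply: opnorm_le => x x1; rewrite -ler_sqr ?nnegrE ?sqrtr_ge0 ?rnorm_ge0 //.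
    rewrite sqr_sqrtr // rnorm_sqr (le_trans (key x)) // ler_piMr //.
    by rewrite -rnorm_sqr expr_le1 ?rnorm_ge0.
  by lra.
set W := numerical_radius _.
have W0 : 0 <= W by exact: numerical_radius_ge0.
have O0 := opnorm_ge0 S.
(* Bound for w^2: a quarter of [W + opnorm S + W], from the three terms of 4 A_u^2. *)
pose L := 1 / 2 * W + 1 / 4 * opnorm S.
have L0 : 0 <= L by rewrite /L; lra.
have wL : w ^+ 2 <= L.
  rewrite -[leRHS]sqr_sqrtr // ler_sqr ?nnegrE ?sqrtr_ge0 //.
  apply: numerical_radius_le; first exact: sqrtr_ge0.
  move=> x x1; rewrite -ler_sqr ?nnegrE ?sqrtr_ge0 ?rnorm_ge0 // sqr_sqrtr //.
  have [u u1 uE] := ex_phase (inner (T x) x).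
  have uu : u * u^* = 1 by rewrite -normCK rnormE u1 expr1n.
  have TT_bound : rnorm (inner (T (T x)) x) <= W.
    have := numerical_radius_ge x (bounded_comp T_bounded T_bounded).
    by rewrite x1 expr1n mulr1.
  pose A := rot_re T T' u.
  have -> : rnorm (inner (T x) x) = rip (A x) x by rewrite rip_rot_re // uE.
  (* Cauchy-Schwarz at a unit vector; symmetry of [A] then turns |A x|^2 into <A^2 x, x>. *)
  apply: le_trans (rip_sqr_le _ _) _.
  rewrite -[rip x x]rnorm_sqr x1 expr1n mulr1.
  rewrite /A -rot_re_sym // rot_re_sqr //.
  have -> : (4^-1 : R[i]) = (4^-1)%:C%C by rewrite fmorphV rmorph_nat.
  rewrite ripZl !ripDl -ripDl -/(S x).
  have uTT : rip (u ^+ 2 *: T (T x)) x <= W.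
    rewrite /rip linearZl_LR (le_trans (Re_le_rnorm _)) //=.
    by rewrite !rnormM u1 !mul1r.
  have uTT' : rip (u^* ^+ 2 *: T' (T' x)) x <= W.
    rewrite /rip linearZl_LR (le_trans (Re_le_rnorm _)) //=.
    (* <T'^2 x, x> is the conjugate of <T^2 x, x>, hence has the same modulus. *)
    rewrite !T'_adj innerC expr2 !rnormM.
    have rC (z : R[i]) : rnorm z^* = rnorm z by rewrite /rnorm norm_conjC.
    by rewrite !rC u1 !mul1r.
  have Sx : rip (S x) x <= opnorm S.
    apply: le_trans (rip_le _ _) _; rewrite x1 mulr1.
    by apply: opnorm_ge; rewrite ?x1.
  by rewrite /L; lra.
have : w ^+ 4 <= L ^+ 2.
  rewrite (_ : w ^+ 4 = (w ^+ 2) ^+ 2); last by rewrite -exprM.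
  by rewrite ler_sqr ?nnegrE ?sqr_ge0.
(* The right-hand side exceeds L^2 by exactly (2 W - |S|)^2 / 16. *)
move=> /le_trans-> //; have := sqr_ge0 (2 * W - opnorm S); rewrite /L; nra.
Qed.
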